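(* Let $X,Y,Z$ be locally convex Hausdorff topological vector spaces, $K\subset Y$ a proper closed convex cone with $\operatorname{int}K\neq\emptyset$, and $S\subset Z$ a nonempty convex cone. Let $\Phi\colon X\times Z\to Y^\infty$ be a $K$-convex mapping with $0_Z\in\pi(\operatorname{dom}\Phi)$, where $\pi(x,z)=z$, and let $Z_0=\operatorname{lin}(\pi(\operatorname{dom}\Phi))$. Assume that for every $L\in\mathcal L(X,Y)$ there exist $y_L\in Y$ and a neighborhood $V_L$ of $0_Z$ such that for every $z\in V_L\cap Z_0$ there is $x\in X$ with $\Phi(x,z)-L(x)\leqq_K y_L$. Then stable strong duality holds for the pair $(\mathrm P)-(\mathrm D)$, i.e. $\operatorname{WInf}(\mathrm P^L)=\operatorname{WMax}(\mathrm D^L)$ for every $L\in\mathcal L(X,Y)$. Moreover, if in addition there exists $\tilde x\in X$ with $(\tilde x,0_Z)\in\operatorname{dom}\Phi$ and $\Phi(\tilde x,z)\leqq_K\Phi(\tilde x,0_Z)$ for all $z\in-S$, then stable strong duality holds for the pair $(\mathrm P)-(\mathrm D_\ell)$ as well, i.e. $\operatorname{WInf}(\mathrm P^L)=\operatorname{WMax}(\mathrm D^L_\ell)$ for every $L\in\mathcal L(X,Y)$.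
   Context: Ordering: $K$ proper means $K\ne Y$. $y_1\leqq_K y_2$ iff $y_1-y_2\in-K$; $y_1<_K y_2$ iff $y_1-y_2\in-\operatorname{int}K$. $Y^\infty=Y\cup\{+\infty_Y\}$, $Y^\bullet=Y\cup\{-\infty_Y,+\infty_Y\}$, where $-\infty_Y<_K y<_K+\infty_Y$ for $y\in Y$, $-\infty_Y<_K+\infty_Y$, $-(\pm\infty_Y)=\mp\infty_Y$, $y+(\pm\infty_Y)=\pm\infty_Y$ for $y\in Y$; in particular $+\infty_Y\not\leqq_K y$ for $y\in Y$. For $M\subset Y^\bullet$: $\operatorname{WSup}M$ is the set of $\bar v\in Y^\bullet$ such that $\bar v\not<_K v$ for all $v\in M$ and for every $\tilde v\in Y^\bullet$ with $\tilde v<_K\bar v$ there is $v\in M$ with $\tilde v<_K v$; $\operatorname{WInf}M=-\operatorname{WSup}(-M)$; $\operatorname{WMax}M=M\cap\operatorname{WSup}M$. $\mathcal L(X,Y)$ is the space of continuous linear maps $X\to Y$. $\operatorname{dom}\Phi=\{(x,z):\Phi(x,z)\neq+\infty_Y\}$; $\Phi$ is $K$-convex if $\{(x,z,y)\in X\times Z\times Y:y\in\Phi(x,z)+K\}$ is convex. $\Phi^*(L,T)=\operatorname{WSup}\{L(x)+T(z)-\Phi(x,z):(x,z)\in X\times Z\}$ for $(L,T)\in\mathcal L(X,Y)\times\mathcal L(Z,Y)$. $\mathcal L_\Phi=\{T\in\mathcal L(Z,Y):\exists L\in\mathcal L(X,Y),\ \Phi^*(L,T)\neq\{+\infty_Y\}\}$,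 $\mathcal L_+(S,K)=\{T\in\mathcal L(Z,Y):T(S)\subset K\}$, $\mathcal L_\Phi^+=\mathcal L_\Phi\cap\mathcal L_+(S,K)$. $\operatorname{lin}$ denotes linear hull. Problems, for $L\in\mathcal L(X,Y)$: $\operatorname{WInf}(\mathrm P^L)=\operatorname{WInf}\{\Phi(x,0_Z)-L(x):x\in X\}$; $\operatorname{WMax}(\mathrm D^L)=\operatorname{WMax}M_L$ with $M_L=\bigcup_{T\in\mathcal L_\Phi}(-\Phi^*(L,T))$; $\operatorname{WMax}(\mathrm D^L_\ell)=\operatorname{WMax}M_L^+$ with $M_L^+=\bigcup_{T\in\mathcal L_\Phi^+}(-\Phi^*(L,T))$. $(\mathrm P),(\mathrm D),(\mathrm D_\ell)$ are the problems with $L=0$.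
   Formalization: When M_L (resp. M_L^+) is empty, the dual value WMax is taken to be {−∞_Y} instead of the literal empty set; otherwise the claim fails, e.g. for Φ(x,z)=f(x) with f a discontinuous linear functional. *)

(* Defs.v *)
From mathcomp Require Import all_boot all_order all_algebra.
From mathcomp Require Import all_classical all_reals all_analysis.

Set Implicit Arguments.
Unset Strict Implicit.
Unset Printing Implicit Defensive.

Import Order.TTheory GRing.Theory Num.Theory.
Import numFieldNormedType.Exports.

Local Open Scope classical_set_scope.
Local Open Scope ring_scope.

(* The extended space Y^bullet = Y U {-oo, +oo} is the library's type
   [\bar Y] of which only the constructors, [oppe] and the addition are used;
   its order comes from the cone K below, not from the library. *)

Section cones.
Context {R : realType} {V : lmodType R}.

(* Dilations by t > 0 only: for closed nonempty cones this is the same as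
   requiring t >= 0, and otherwise 0 may or may not be in the cone. *)
Definition cone (C : set V) : Prop :=
  forall (t : R) (v : V), 0 < t -> C v -> C (t *: v).

Definition linear_subspace (F : set V) : Prop :=
  F 0 /\ forall (a : R) (u v : V), F u -> F v -> F (a *: u + v).

Definition lin (A : set V) : set V := smallest linear_subspace A.

End cones.

Section vector_order.
Context {R : realType} {Y : tvsType R}.
Variable K : set Y.

Definition leK (u v : \bar Y) : Prop :=
  match u, v with
  | y1%:E, y2%:E => (-%R @` K) (y1 - y2)
  | -oo%E, _ => True
  | _, +oo%E => True
  | _, _ => False
  end.

Definition ltK (u v : \bar Y) : Prop :=
  match u, v with
  | y1%:E, y2%:E => (-%R @` K°) (y1 - y2)
  | -oo%E, _%:E => True
  | -oo%E, +oo%E => True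
  | _%:E, +oo%E => True
  | _, _ => False
  end.

Definition WSup (M : set (\bar Y)) : set (\bar Y) :=
  [set v | (forall u, M u -> ~ ltK v u) /\
           (forall w, ltK w v -> exists2 u, M u & ltK w u)].

Definition WInf (M : set (\bar Y)) : set (\bar Y) :=
  oppe @` WSup (oppe @` M).

Definition WMax (M : set (\bar Y)) : set (\bar Y) := M `&` WSup M.

(* Value of the maximization problem "WMax M". It is WMax M as soon as M is
   nonempty. For a problem without feasible points it is {-oo}, the usual
   convention max {} = -oo, in agreement with WSup {} = {-oo}; taken literally,
   WMax {} is the empty set, which never equals a set of the form WInf M. *)
Definition WMax_value (M : set (\bar Y)) : set (\bar Y) :=
  WMax M `|` [set v | M = set0 /\ v = -oo%E].

End vector_order.

Definition continuous_linear (R : realType) (V W : tvsType R) :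
    set {linear V -> W} := [set L | continuous L].

Section perturbation.
Context {R : realType} {X Y Z : tvsType R}.
Variables (S : set Z) (K : set Y) (Phi : X * Z -> \bar Y).

Definition dom : set (X * Z) := [set p | Phi p <> +oo%E].

Definition pi_dom : set Z := snd @` dom.

(* Since Phi p + k = +oo when Phi p = +oo, only points of the domain
   contribute. *)
Definition K_epigraph : set ((X * Z) * Y) :=
  [set q | exists2 k, K k & q.2%:E = (Phi q.1 + k%:E)%E].

Definition K_convex : Prop := convex_set K_epigraph.

Definition conjugate (L : {linear X -> Y}) (T : {linear Z -> Y}) :
    set (\bar Y) :=
  WSup K [set ((L p.1 + T p.2)%:E - Phi p)%E | p in [set: X * Z]].

Definition L_Phi : set {linear Z -> Y} :=
  [set T | continuous_linear T /\
     exists L : {linear X -> Y},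
       continuous_linear L /\ conjugate L T <> [set +oo%E]].

Definition L_pos : set {linear Z -> Y} :=
  [set T | continuous_linear T /\ T @` S `<=` K].

Definition L_Phi_pos : set {linear Z -> Y} := L_Phi `&` L_pos.

(* WInf (P^L) *)
Definition primal_value (L : {linear X -> Y}) : set (\bar Y) :=
  WInf K [set (Phi (x, 0%R) - (L x)%:E)%E | x in [set: X]].

(* WMax (D^L) *)
Definition dual_value (L : {linear X -> Y}) : set (\bar Y) :=
  WMax_value K (\bigcup_(T in L_Phi) (oppe @` conjugate L T)).

(* WMax (D_l^L), the loose dual problem *)
Definition loose_dual_value (L : {linear X -> Y}) : set (\bar Y) :=
  WMax_value K (\bigcup_(T in L_Phi_pos) (oppe @` conjugate L T)).

End perturbation.

(* Main.v *)
Require Import Defs.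
From HB Require Import structures.
From mathcomp Require Import all_boot all_order all_algebra.
From mathcomp Require Import all_classical all_reals all_analysis.
From mathcomp Require Import ring lra.

Set Implicit Arguments.
Unset Strict Implicit.
Unset Printing Implicit Defensive.

Import Order.TTheory GRing.Theory Num.Theory.
Import numFieldNormedType.Exports.

Local Open Scope classical_set_scope.
Local Open Scope ring_scope.

(** A point [v] of [WInf (P^L)] lies on the boundary of the image epigraph
    [E = {(z, y) : Phi (x, z) - L x <=_K y for some x}], so a linear
    functional [(zeta, eta)] separates [(0, v)] from [E]. The regularity
    condition makes [zeta] continuous and [eta] positive on the interior of
    [K]; normalizing [eta k0 = 1] for some [k0] in that interior, [T z = -
    zeta(z) k0] is a dual solution with [-v] in the conjugate of [Phi] at
    [(L, T)], and [zeta <= 0] on [S] under the additional hypothesis.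
    Conversely, a point [v] of the dual value below which no primal value
    lies, but which is not a weak infimum, could be moved upwards in the
    direction [k0] to a weak infimum, which is again dual attained,
    contradicting the maximality of [v]. *)

(** * Algebraic separation through maximal blunt convex cones *)

Section blunt_cones.
Context {R : realType} {W : lmodType R}.

Definition blunt_convex_cone (G : set W) : Prop :=
  [/\ ~ G 0, cone G & forall u v, G u -> G v -> G (u + v)].

(** Zorn's lemma; were neither [a] nor [- a] in a maximal cone, adjoining the ray of [a] would give
    a larger cone still avoiding 0. *)
Lemma maximal_blunt_convex_cone (G : set W) : blunt_convex_cone G ->
  exists M, [/\ G `<=` M, blunt_convex_cone M &
    forall a, a <> 0 -> M a \/ M (- a)].
Proof.
move=> [G0 Gc GD].
(* Zorn's lemma is applied to the sets whose union with [G] is a blunt convex cone, so that the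
   empty chain has an admissible union. *)
have [F FP Ftot|A [[A0 Ac AD] Amax]] :=
  @Zorn_bigcup W [set A | blunt_convex_cone (A `|` G)].
  split=> [[[A FA A0]|//]|t v t0|u v].
  - by have [+ _ _] := FP _ FA; apply; left.
  - case=> [[A FA Av]|Gv]; last by right; exact: Gc.
    have [_ Ac _] := FP _ FA.
    by have [Atv|] := Ac _ _ t0 (or_introl Av); [left; exists A|right].
  - have sub A : F A -> A `|` G `<=` \bigcup_(X in F) X `|` G.
      by move=> FA w [Aw|]; [left; exists A|right].
    case=> [[A FA Au]|Gu] [[B FB Bv]|Gv].
    + have [AB|BA] := Ftot _ _ FA FB.
        have [_ _ D] := FP _ FB.
        by apply: (sub _ FB); apply: D; left => //; exact: AB.
      have [_ _ D] := FP _ FA.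
      by apply: (sub _ FA); apply: D; left => //; exact: BA.
    + have [_ _ D] := FP _ FA.
      by apply: (sub _ FA); apply: D; [left|right].
    + have [_ _ D] := FP _ FB.
      by apply: (sub _ FB); apply: D; [right|left].
    + by right; exact: GD.
exists (A `|` G); split=> // a a0.
apply: contrapT => /not_orP[nMa nMNa].
pose M := A `|` G.
(* The cone generated by [M] and [a]; the third condition excludes only the trivial combination
   [m = 0], [s = 0]. *)
pose M' := [set w | exists m s, [/\ M m \/ m = 0, 0 <= s,
   M m \/ 0 < s & w = m + s *: a]].
have MM' : M `<=` M'.
  by move=> m Mm; exists m, 0; rewrite scale0r addr0; split; [left| |left|].
have M'G : M' `|` G = M'.
  by apply/setUidPl => w Gw; apply: MM'; right.
apply: (Amax M'); last rewrite /= M'G.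
  split; first by move=> w Aw; apply: MM'; left.
  move=> /(_ a) M'A; apply: nMa; left; apply: M'A.
  by exists 0, 1; rewrite scale1r add0r; split; [right| |right|].
split.
- move=> [m] [s] [Mm s0 Mms /esym/eqP].
  rewrite addrC addr_eq0 => /eqP sa.
  have [s00|sn0] := eqVneq s 0.
    case: Mms => [{}Mm|]; last by rewrite s00 ltxx.
    by move: sa; rewrite s00 scale0r => /esym/eqP; rewrite oppr_eq0 => /eqP m0;
      apply: A0; rewrite -m0.
  have sp : 0 < s by rewrite lt_neqAle eq_sym sn0.
  have aE : - a = s^-1 *: m.
    by rewrite -[m]opprK -sa scalerN scalerA mulVf// scale1r.
  case: Mm => [Mm|m0]; first
    by apply: nMNa; rewrite aE; apply: Ac; rewrite ?invr_gt0.
  by apply: a0; apply/eqP; rewrite -oppr_eq0 aE m0 scaler0.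
- move=> t v t0 [m] [s] [Mm s0 Mms ->].
  exists (t *: m), (t * s); split.
  + by case: Mm => [?|->]; [left; exact: Ac|right; rewrite scaler0].
  + by rewrite mulr_ge0// ltW.
  + by case: Mms => [?|?]; [left; exact: Ac|right; rewrite mulr_gt0].
  + by rewrite scalerDr scalerA.
- move=> u v [m] [s] [Mm s0 Mms ->] [m'] [s'] [Mm' s0' Mms' ->].
  exists (m + m'), (s + s'); split.
  + case: Mm Mm' => [Mm|->] [Mm'|->]; rewrite ?add0r ?addr0.
    * by left; exact: AD.
    * by left.
    * by left.
    * by right.
  + exact: addr_ge0.
  + case: Mm => [Mm|m0]; last first.
      case: Mms => [Mm|sp]; last by right; rewrite ltr_wpDr.
      by exfalso; apply: A0; rewrite -m0.
    left; case: Mm' => [Mm'|->]; last by rewrite addr0.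
    exact: AD.
  + by rewrite scalerDl addrACA.
Qed.

(* The functional sends [w] to the level [t] at which [w - t *: e] crosses the
   boundary of a maximal cone containing [G]. *)
Lemma blunt_convex_cone_separation (G : set W) (e : W) :
  blunt_convex_cone G -> (forall w, exists2 t, 0 < t & G (w - t *: e)) ->
  exists f : {linear W -> R^o}, f e = 1 /\ forall w, G w -> f w <= 0.
Proof.
move=> /maximal_blunt_convex_cone[M [GM [M0 Mc MD] Mtot]] core.
have MNe : M (- e).
  have [t t0 /GM] := core 0; rewrite sub0r.
  move/(Mc t^-1); rewrite invr_gt0 => /(_ t0).
  by rewrite scalerN scalerA mulVf ?gt_eqF// scale1r.
have MB w s t : s < t -> M (w - s *: e) -> M (w - t *: e).
  move=> st Mw; have -> : w - t *: e = (w - s *: e) + (t - s) *: (- e).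
    by rewrite scalerN scalerBl opprB addrA subrK.
  by apply: MD => //; apply: Mc; rewrite ?subr_gt0.
pose S w := [set t | M (w - t *: e)].
have Sup w : exists x, S w x.
  by have [t _ /GM] := core w; exists t.
have Slow w : exists b, lbound (S w) b.
  have [b _ /GM Mb] := core (- w).
  exists (- b) => t /= St; rewrite leNgt; apply/negP => tb.
  have /MD/(_ Mb) : M (w - (- b) *: e) by exact: MB St.
  by rewrite scaleNr opprK addrACA subrr add0r subrr.
pose f w := inf (S w).
have fgt w t : f w < t -> M (w - t *: e).
  by move=> /(inf_lt (Sup w))[s Ss st]; exact: MB Ss.
(* Below the infimum membership fails, so totality gives the opposite vector. It is invoked at the
   midpoint [u]; the gap [u - t] covers the case [w = u *: e], where totality says nothing. *)
have flt w t : t < f w -> M (t *: e - w).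
  move=> tf; pose u := (t + f w) / 2.
  have tu : t < u by rewrite /u; lra.
  have uf : u < f w by rewrite /u; lra.
  have nM : ~ M (w - u *: e).
    move=> Mu; have : f w <= u by apply: ge_inf => //; exact: Slow.
    by rewrite leNgt uf.
  have -> : t *: e - w = (u *: e - w) + (u - t) *: (- e).
    by rewrite scalerN scalerBl opprB [RHS]addrC addrA subrK.
  have Mut : M ((u - t) *: (- e)) by apply: Mc; rewrite ?subr_gt0.
  have [wu|/eqP/Mtot[//|]] := eqVneq (w - u *: e) 0.
    by rewrite -[u *: e - w]opprB wu oppr0 add0r.
  by rewrite opprB => Mu; exact: MD.
(* Membership on both sides determines [f w], so linearity reduces to the cone operations on [M]. *)
have fE w c : (forall t, c < t -> M (w - t *: e)) ->
    (forall t, t < c -> M (t *: e - w)) -> f w = c.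
  move=> gtc ltc; apply/eqP; rewrite eq_le; apply/andP.
  split; rewrite leNgt; apply/negP.
  - move=> cf; pose u := (c + f w) / 2.
    have /gtc Mu : c < u by rewrite /u; lra.
    have /flt/(MD _ _ Mu) : u < f w by rewrite /u; lra.
    by rewrite addrA subrK subrr.
  - move=> cf; pose u := (c + f w) / 2.
    have /ltc Mu : u < c by rewrite /u; lra.
    have /fgt/(MD _ _ Mu) : f w < u by rewrite /u; lra.
    by rewrite addrA subrK subrr.
clearbody f.
have fD u v : f (u + v) = f u + f v.
  apply: fE => t tc.
  - pose d := (t - (f u + f v)) / 2.
    have -> : u + v - t *: e = (u - (f u + d) *: e) + (v - (f v + d) *: e).
      rewrite addrACA -opprD -scalerDl; congr (_ - _ *: _); rewrite /d; lra.
    by apply: MD; apply: fgt; rewrite /d; lra.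
  - pose d := ((f u + f v) - t) / 2.
    have -> : t *: e - (u + v) = ((f u - d) *: e - u) + ((f v - d) *: e - v).
      rewrite addrACA -opprD -scalerDl; congr (_ *: e - _); rewrite /d; lra.
    by apply: MD; apply: flt; rewrite /d; lra.
have f0 : f 0 = 0 by have := fD 0 0; rewrite addr0; lra.
have fN u : f (- u) = - f u by have := fD u (- u); rewrite subrr f0; lra.
have fZp a u : 0 < a -> f (a *: u) = a * f u.
  move=> a0; have aa x : a * (a^-1 * x) = x.
    by rewrite mulrA divff ?gt_eqF ?mul1r.
  apply: fE => t tc.
  - have -> : a *: u - t *: e = a *: (u - (a^-1 * t) *: e).
      by rewrite scalerBr scalerA aa.
    by apply: Mc => //; apply: fgt; rewrite ltr_pdivlMl.
  - have -> : t *: e - a *: u = a *: ((a^-1 * t) *: e - u).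
      by rewrite scalerBr scalerA aa.
    by apply: Mc => //; apply: flt; rewrite ltr_pdivrMl.
have flin : linear (f : W -> R^o).
  move=> a u v; rewrite fD; congr (_ + _).
  have [a0|a0|->] := ltgtP a 0; last by rewrite scale0r f0 scale0r.
  - by rewrite -[a]opprK scaleNr fN fZp ?oppr_gt0// scaleNr.
  - exact: fZp.
pose fL := GRing.isLinear.Build R W R^o _ (f : W -> R^o) flin.
pose F : {linear W -> R^o} := HB.pack (f : W -> R^o) fL.
exists F; split=> [|w /GM Mw].
  apply: fE => t tc.
  - rewrite -{1}[e]scale1r -scalerBl -opprB scaleNr -scalerN.
    by apply: Mc; rewrite ?subr_gt0.
  - rewrite -{2}[e]scale1r -scalerBl -opprB scaleNr -scalerN.
    by apply: Mc; rewrite ?subr_gt0.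
rewrite leNgt; apply/negP => fw.
have /flt : 0 < f w by [].
by rewrite scale0r sub0r => /(MD _ _ Mw); rewrite subrr.
Qed.

End blunt_cones.

(** * Nonnegative combinations in convex sets *)

Section convex_combinations.
Context {R : realType} {W : lmodType R}.

(** Dividing by [a + b] gives a convex combination; if [a = b = 0], both sides vanish and any point
    serves. *)
Lemma convex_set_combination (A : set W) (a b : R) (x y : W) : convex_set A ->
  0 <= a -> 0 <= b -> A x -> A y ->
  exists2 w, A w & a *: x + b *: y = (a + b) *: w.
Proof.
move=> cA a0 b0 Ax Ay.
have [ab0|abn0] := eqVneq (a + b) 0.
  have /andP[/eqP -> /eqP ->] : (a == 0) && (b == 0).
    by rewrite -paddr_eq0// ab0.
  by exists x; rewrite // addr0 !scale0r addr0.
have ab : 0 < a + b by rewrite lt_neqAle eq_sym abn0 addr_ge0.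
have p0 : 0 <= a / (a + b) by rewrite divr_ge0// ltW.
have p1 : a / (a + b) <= 1 by rewrite ler_pdivrMr// mul1r lerDl.
exists ((a / (a + b)) *: x + (1 - a / (a + b)) *: y).
  by apply/set_mem; apply: (cA x y (Itv01 p0 p1)); exact/mem_set.
rewrite scalerDr !scalerA; congr (_ *: _ + _ *: _); field => //.
Qed.

Lemma convex_coneD (C : set W) : convex_set C -> cone C ->
  forall x y, C x -> C y -> C (x + y).
Proof.
move=> cC coneC x y Cx Cy.
have [w Cw] := convex_set_combination cC ler01 ler01 Cx Cy.
by rewrite !scale1r => ->; apply: coneC.
Qed.

End convex_combinations.

(** * Neighborhoods and cones with interior in locally convex spaces *)

Section tvs_neighborhoods.
Context {R : realType} {V : tvsType R}.

Lemma nbhs_absorb (x y : V) (U : set V) : nbhs x U ->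
  exists2 d : R, 0 < d & forall t, `|t| < d -> U (x + t *: y).
Proof.
move=> Ux.
have xE : x = x + (0 : R^o) *: y by rewrite scale0r addr0.
have : (fun t : R^o => x + t *: y) @ (0 : R^o) --> x.
  rewrite {2}xE; apply: (@continuous_comp _ _ _ (fun t : R^o => (x, t *: y))
    (fun u : V * V => u.1 + u.2)); last exact: add_continuous.
  apply: cvg_pair => /=; first exact: cvg_cst.
  apply: (@continuous_comp R^o (R^o * V)%type V (fun t => (t, y))
    (fun u => u.1 *: u.2)); last exact: scale_continuous.
  apply: (@cvg_pair _ _ _ _ (nbhs (0 : R^o))) => /=; first exact: cvg_id.
  exact: cvg_cst.
move=> /(_ U Ux) [d /= d0 dU]; exists d => // t td.
by apply: dU; rewrite /= sub0r normrN.
Qed.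

Lemma nbhs0_absolutely_convex (U : set V) : nbhs 0 U -> exists A : set V,
  [/\ nbhs 0 A, A `<=` U, convex_set A & forall z, A z -> A (- z)].
Proof.
move=> U0; have [B Bcvx [Bopen Bbasis]] := @locally_convex R V.
have [A [BA A0] AU] := Bbasis 0 U U0.
have cA := Bcvx _ (mem_set BA).
have nA : nbhs 0 A by apply: open_nbhs_nbhs; split => //; exact: Bopen.
have nAN := nbhs0N nA.
exists (A `&` (-%R @` A)); split.
- exact: filterI.
- by move=> z [/AU].
- move=> x y l /set_mem[Ax [x' Ax' x'E]] /set_mem[Ay [y' Ay' y'E]].
  apply/mem_set; split; first by apply/set_mem/cA; exact/mem_set.
  exists (conv l (x' : convex_lmodType V) (y' : convex_lmodType V)).
    by apply/set_mem/cA; exact/mem_set.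
  by rewrite -x'E -y'E /conv/= opprD !scalerN.
- move=> z [Az [z' Az' z'E]]; split; first by rewrite -z'E opprK.
  by exists z.
Qed.

Lemma bounded_functional_continuous (f : {linear V -> R^o}) (A : set V) (c : R) :
  nbhs 0 A -> (forall z, A z -> `|f z| <= c) -> continuous f.
Proof.
move=> A0 fc z; apply/cvgrPdist_lt => e e0.
have c0 : 0 <= c by apply: le_trans (fc 0 _) => //; exact: nbhs_singleton.
(* On [r *: A] the functional is at most [e * c / (c + 1)], strictly below [e] even when [c = 0]. *)
pose r := e / (c + 1).
have r0 : 0 < r by rewrite divr_gt0// ltr_wpDl.
apply: filterS (nbhsT z (nbhs0Z (lt0r_neq0 r0) A0)).
move=> _ [_ [a Aa <-] <-] /=.
have -> : f (z + r *: a) = f z + r * f a by rewrite linearD linearZ.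
rewrite opprD addrA subrr add0r normrN normrM (gtr0_norm r0).
apply: le_lt_trans (ler_wpM2l (ltW r0) (fc _ Aa)) _.
rewrite /r mulrAC ltr_pdivrMr ?ltr_wpDl// mulrDr mulr1 ltrDl//.
Qed.

Variable K : set V.
Hypotheses (K_cvx : convex_set K) (K_cone : cone K).

Lemma interior_coneD x y : K x -> K° y -> K° (x + y).
Proof.
move=> Kx Ky; apply: filterS (nbhsB x Ky) => _ [k Kk <-].
exact: convex_coneD.
Qed.

Lemma interior_coneZ : cone K°.
Proof.
move=> t x t0 Kx; apply: filterS (nbhsZ (lt0r_neq0 t0) Kx) => _ [k Kk <-].
exact: K_cone.
Qed.

(** [k + r *: y] stays interior for small [r], and dilation by [r^-1] concludes: interior points act
    as order units. *)
Lemma interior_cone_absorb k y : K° k -> exists2 t, 0 < t & K° (t *: k + y).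
Proof.
move=> Kk.
have /(nbhs_absorb y)[d d0 dK] : nbhs k K°.
  by apply: open_nbhs_nbhs; split => //; exact: open_interior.
pose r := d / 2.
have r0 : 0 < r by rewrite divr_gt0.
exists r^-1; first by rewrite invr_gt0.
have -> : r^-1 *: k + y = r^-1 *: (k + r *: y).
  by rewrite scalerDr scalerA mulVf ?gt_eqF// scale1r.
apply: interior_coneZ; first by rewrite invr_gt0.
by apply: dK; rewrite gtr0_norm// /r; lra.
Qed.

Lemma proper_cone_interior0 : K <> [set: V] -> ~ K° 0.
Proof.
move=> Kproper K0; apply: Kproper; apply/seteqP; split=> // y _.
have [t _ /interior_subset] := interior_cone_absorb y K0.
by rewrite scaler0 add0r.
Qed.

(** Small multiples of [k] tend to 0; as [cone] speaks of positive dilations only, 0 is reached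
    through closedness. *)
Lemma closed_cone0 : closed K -> K !=set0 -> K 0.
Proof.
move=> /closure_id K_cl [k Kk]; rewrite K_cl => B /(nbhs_absorb k)[d d0 dB].
exists ((d / 2) *: k); split; first by apply: K_cone => //; exact: divr_gt0.
by rewrite -[_ *: _]add0r; apply: dB; rewrite gtr0_norm ?divr_gt0//; lra.
Qed.

End tvs_neighborhoods.

(** * Continuous affine minorants of a convex set *)

(* [E] is separated from the convex cone of all [(l z, v + l (v - yL) - k)] with
   [l >= 0], [z] in [V] and [k] in the interior of [K]. Unlike [E], whose
   interior is only relative to the subspace [F], this cone is open, so that
   the separating functional is continuous on the whole of [Z], and no
   extension from [F] to [Z] is required. *)
Lemma affine_minorant (R : realType) (Y Z : tvsType R) (K : set Y)
    (E : set (Z * Y)) (F V : set Z) (yL v : Y) :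
  K <> [set: Y] -> closed K -> convex_set K -> cone K -> K° !=set0 ->
  convex_set E -> linear_subspace F -> (forall p, E p -> F p.1) ->
  nbhs 0 V -> (forall z, V z -> F z -> E (z, yL)) ->
  (forall y, E (0, y) -> ~ K° (v - y)) ->
  exists T : {linear Z -> Y}, [/\ continuous T,
    forall p, E p -> ~ K° (v + T p.1 - p.2) &
    forall z y, (forall t, 0 < t -> E (- (t *: z), y)) -> K (T z)].
Proof.
move=> Kprop Kcl Kcvx Kcone [k0 Kk0] Ecvx [F0 Flin] EF V0 VE Ev.
have [A [A0 AV Acvx AN]] := nbhs0_absolutely_convex V0.
have FZ a z : F z -> F (a *: z).
  by move=> Fz; rewrite -[_ *: _]addr0; exact: Flin.
have AE z : A z -> F z -> E (z, yL) by move=> /AV; exact: VE.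
have A00 : A 0 by exact: nbhs_singleton.
have E00 : E (0, yL) by exact: AE.
have Kint0 := proper_cone_interior0 Kcone Kprop.
have KZ := @interior_coneZ _ _ _ Kcone.
have KD := interior_coneD Kcvx Kcone.
have Eint y r k : E (0, y) -> 0 < r -> K° k -> ~ r *: (v - y) = k.
  move=> Ey r0 Kk vyk; apply: (Ev y Ey).
  rewrite -[v - y]scale1r -(mulVf (lt0r_neq0 r0)) -scalerA vyk.
  by apply: KZ => //; rewrite invr_gt0.
(* The cone described above minus the cone generated by [E], with [(0, v)] moved to the origin. The
   vector [(z, v - yL)] comes from reflecting [(- z, yL)] through [(0, v)], a point of [E] when [z]
   is in [A] and [F]. *)
pose G := [set w : Z * Y | exists l s z k p,
  [/\ 0 <= l, 0 <= s, A z, K° k & E p] /\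
  w = (l *: z - s *: p.1, l *: (v - yL) - k - s *: (p.2 - v))].
have Gblunt : blunt_convex_cone G.
  split.
  (* If 0 is in [G], then [z] is in [F] unless [l = 0], and combining [(- z, yL)] with [p] gives
     [(0, w2)] in [E] with [v - w2] interior to [K], against [Ev]; [l = s = 0] would make 0
     interior. *)
  - move=> [l [s [z [k [p [[l0 s0 Az Kk Ep] [/esym/eqP wz /esym/eqP wy]]]]]]].
    have {}wz : l *: z = s *: p.1 by apply/eqP; rewrite -subr_eq0.
    have {}wy : l *: (v - yL) + s *: (v - p.2) = k.
      apply/eqP; rewrite -subr_eq0 -(eqP wy) -[v - p.2]opprB scalerN.
      by rewrite addrAC.
    have [q] : exists q : Z * Y, E q /\ l *: q = (- (l *: z), l *: yL).
      have [l00|ln0] := eqVneq l 0.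
        by exists p; rewrite l00 !scale0r oppr0.
      exists (- z, yL); split; last by rewrite -scalerN.
      apply: AE; first exact: AN.
      have -> : - z = - (l^-1 * s) *: p.1.
        by rewrite scaleNr -scalerA -wz scalerA mulVf// scale1r.
      by apply: FZ; exact: EF.
    move=> [Eq lq].
    have [[w1 w2] Ew wE] := convex_set_combination Ecvx l0 s0 Eq Ep.
    have [ls0|lsn0] := eqVneq (l + s) 0.
      move: ls0 => /eqP; rewrite paddr_eq0// => /andP[/eqP l00 /eqP s00].
      by apply: Kint0; rewrite -wy l00 s00 !scale0r addr0 in Kk *.
    have ls : 0 < l + s by rewrite lt_neqAle eq_sym lsn0 addr_ge0.
    move: wE; rewrite lq => -[/esym/eqP + w2E].
    rewrite wz addNr scaler_eq0 (negbTE lsn0) /= => /eqP w10.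
    apply: (Eint w2 (l + s) k) => //; first by rewrite -w10.
    rewrite -wy scalerBr -w2E scalerDl !scalerBr opprD.
    by rewrite addrACA.
  - move=> t _ t0 [l [s [z [k [p [[l0 s0 Az Kk Ep] ->]]]]]].
    exists (t * l), (t * s), z, (t *: k), p; split.
      by split; rewrite ?mulr_ge0 ?(ltW t0)//; exact: KZ.
    by congr pair; rewrite /= !scalerBr !scalerA.
  - move=> u u' [l [s [z [k [p [[l0 s0 Az Kk Ep] ->]]]]]].
    move=> [l' [s' [z' [k' [p' [[l0' s0' Az' Kk' Ep'] ->]]]]]].
    have [z'' Az'' z''E] := convex_set_combination Acvx l0 l0' Az Az'.
    have [p'' Ep'' p''E] := convex_set_combination Ecvx s0 s0' Ep Ep'.
    exists (l + l'), (s + s'), z'', (k + k'), p''; split.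
      by split; rewrite ?addr_ge0//; apply: KD => //; exact: interior_subset.
    have p1E : s *: p.1 + s' *: p'.1 = (s + s') *: p''.1.
      by have /(congr1 fst) := p''E.
    have p2E : s *: (p.2 - v) + s' *: (p'.2 - v) = (s + s') *: (p''.2 - v).
      have /(congr1 snd) /= p2E := p''E.
      by rewrite !scalerBr -p2E scalerDl opprD addrACA.
    congr pair; rewrite /=; first by rewrite addrACA z''E -opprD p1E.
    by rewrite -p2E scalerDl !opprD addrACA; congr (_ + _); rewrite addrACA.
have [z|f [f1 fG]] := @blunt_convex_cone_separation R
  (Z * Y)%type G (0, k0) Gblunt.
  have [d d0 dA] := nbhs_absorb z.1 A0.
  (* This brings [l^-1 *: z.1] into [A]; the second component is then matched by a [t] for which the
     required [k] is interior. *)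
  pose l := 2 / d.
  have l0 : 0 < l by rewrite divr_gt0.
  have [t t0 Kt] := interior_cone_absorb Kcone (l *: (v - yL) - z.2) Kk0.
  exists t => //; exists l, 0, (l^-1 *: z.1),
    (t *: k0 + (l *: (v - yL) - z.2)), (0, yL).
  split.
    split=> //; first exact: ltW.
    rewrite -[_ *: _]add0r; apply: dA.
    by rewrite gtr0_norm ?invr_gt0// /l invf_div; lra.
  case: z {dA Kt} => z y; congr pair => /=.
    by rewrite scaler0 scale0r scalerA mulfV ?gt_eqF// scale1r.
  rewrite scale0r subr0 opprD addrCA opprB addrC.
  by rewrite [X in _ = X + _]addrC subrK addrC.
pose a z := f (z, 0); pose b y := f (0, y).
have fE z y : f (z, y) = a z + b y.
  by rewrite -linearD; congr (f _); congr pair; rewrite /= ?addr0 ?add0r.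
have bD y y' : b (y + y') = b y + b y'.
  by rewrite -linearD; congr (f _); congr pair; rewrite /= addr0.
have bZ r y : b (r *: y) = r * b y.
  by rewrite -[RHS]linearZ; congr (f _); congr pair; rewrite /= scaler0.
have bN y : b (- y) = - b y by rewrite -scaleN1r bZ mulN1r.
have aZ r z : a (r *: z) = r * a z.
  by rewrite -[RHS]linearZ; congr (f _); congr pair; rewrite /= scaler0.
have aN z : a (- z) = - a z by rewrite -scaleN1r aZ mulN1r.
have alin : linear (a : Z -> R^o).
  move=> r z z'; rewrite -[r *: a z]aZ -linearD; congr (f _); congr pair.
  by rewrite /= addr0.
have bk0 : b k0 = 1 by [].
(* Elements of [G] with [l = 1], [s = 0] bound [a] above on [A]; symmetry of [A] bounds it below. *)
have aA z : A z -> `|a z| <= - b (v - yL - k0).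
  have le z' : A z' -> a z' <= - b (v - yL - k0).
    move=> Az'; rewrite -subr_le0 opprK -fE; apply: fG.
    exists 1, 0, z', k0, (0, yL); split; first by split.
    by congr pair; rewrite !scale1r !scale0r subr0.
  move=> Az; rewrite ler_norml le// andbT lerNl -aN; apply: le; exact: AN.
pose aL := GRing.isLinear.Build R Z R^o _ (a : Z -> R^o) alin.
pose al : {linear Z -> R^o} := HB.pack (a : Z -> R^o) aL.
have acont : continuous (a : Z -> R^o).
  exact: (@bounded_functional_continuous _ _ al A _ A0 aA).
pose T z := - a z *: k0.
have Tlin : linear T.
  move=> r z z'; rewrite /T alin scalerA -scalerDl; congr (_ *: _).
  by rewrite opprD mulrN.
pose TL := GRing.isLinear.Build R Z Y _ T Tlin.
pose Tl : {linear Z -> Y} := HB.pack T TL.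
(* With [t *: k - k0] interior, nonpositivity of [f] on [G] gives [1 <= t * b k]. *)
have bK k : K° k -> 0 < b k.
  move=> Kk; have [t t0 Kt] := interior_cone_absorb Kcone (- k0) Kk.
  have : f (0, - (t *: k - k0)) <= 0.
    apply: fG; exists 0, 0, 0, (t *: k - k0), (0, yL); split; first by split.
    by congr pair; rewrite /= !scale0r subr0 ?sub0r.
  rewrite -/(b _) bN bD bN bZ bk0 => h.
  have : 0 < t * b k by lra.
  by rewrite pmulr_rgt0.
(* [G] requires an interior [k]; [e *: k0] is used and [e] tends to 0. *)
have abE p : E p -> 0 <= a p.1 + b (p.2 - v).
  move=> Ep; apply/ler_addgt0Pr => e e0.
  have : f (- p.1, - (e *: k0) - (p.2 - v)) <= 0.
    apply: fG; exists 0, 1, 0, (e *: k0), p; split.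
      by split => //; exact: KZ.
    by congr pair; rewrite /= !scale0r !scale1r sub0r.
  by rewrite fE aN bD !bN bZ bk0; lra.
exists Tl; split.
- move=> z; apply: (@continuous_comp Z (R^o * Y)%type Y (fun z => (- a z, k0))
    (fun u => u.1 *: u.2)); last exact: scale_continuous.
  apply: (@cvg_pair _ _ _ _ (nbhs (- a z : R^o))) => /=; last exact: cvg_cst.
  exact: (@cvgN _ R^o _ _ _ _ _ (acont z)).
- move=> [z y] /[dup] /abE /= h Ep; rewrite /Tl /= /T => /bK.
  rewrite !(bD, bZ, bN) bk0 in h *; lra.
- move=> z y Ezy; rewrite /Tl /= /T.
  have az : a z <= 0.
    rewrite leNgt; apply/negP => az.
    (* At [t = c / a z] the inequality [abE] would read [c <= b (y - v)], impossible for this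
       [c]. *)
    pose c := `|b (y - v)| + 1.
    have c0 : 0 < c by rewrite ltr_wpDl.
    have := abE _ (Ezy (c / a z) (divr_gt0 c0 az)).
    rewrite /= aN aZ divfK ?gt_eqF// /c.
    have := ler_norm (b (y - v)); lra.
  have [->|azn0] := eqVneq (a z) 0.
    rewrite oppr0 scale0r; apply: (closed_cone0 Kcone Kcl).
    by exists k0; exact: interior_subset.
  by apply: Kcone; [rewrite oppr_gt0 lt_neqAle azn0|exact: interior_subset].
Qed.

(** * Weak infima in the extended space *)

Section extended_order.
Context {R : realType} {Y : tvsType R}.
Variable K : set Y.

Lemma oppr_image (A : set Y) (x y : Y) : (-%R @` A) (x - y) <-> A (y - x).
Proof.
split=> [[a Aa axy]|Ayx]; last by exists (y - x); rewrite // opprB.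
by rewrite -opprB -axy opprK.
Qed.

Lemma ltK_fin (x y : Y) : ltK K x%:E y%:E <-> K° (y - x).
Proof. exact: oppr_image. Qed.

Lemma leK_fin (x y : Y) : leK K x%:E y%:E <-> K (y - x).
Proof. exact: oppr_image. Qed.

Lemma ltKN (u v : \bar Y) : ltK K (oppe u) (oppe v) <-> ltK K v u.
Proof.
case: u v => [x||] [y||] //.
by rewrite /oppe !ltK_fin opprK addrC.
Qed.

Lemma oppe_extK : involutive (oppe : \bar Y -> \bar Y).
Proof. by case=> [y||] //; rewrite /oppe opprK. Qed.

Lemma WInfP (A : set (\bar Y)) (v : \bar Y) : WInf K A v <->
  (forall a, A a -> ~ ltK K a v) /\
  (forall w, ltK K v w -> exists2 a, A a & ltK K a w).
Proof.
split=> [[u [u1 u2] <-]|[v1 v2]].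
- split=> [a Aa|w].
    by rewrite -[a]oppe_extK ltKN; apply: u1; exists a.
  rewrite -[w]oppe_extK ltKN => /u2[_ [a Aa <-]].
  by rewrite ltKN oppe_extK; exists a.
- exists (oppe v); last exact: oppe_extK.
  split=> [_ [a Aa <-]|w]; first by rewrite ltKN; exact: v1.
  rewrite -[w]oppe_extK ltKN => /v2[a Aa aw].
  by exists (oppe a); [exists a|rewrite ltKN].
Qed.

Hypotheses (K_closed : closed K) (K_cvx : convex_set K) (K_cone : cone K).
Hypothesis K_int : K° !=set0.

Lemma ltK_leK_trans (u : \bar Y) (x y : Y) :
  ltK K u x%:E -> K (y - x) -> ltK K u y%:E.
Proof.
case: u => [u||//]; last by [].
rewrite !ltK_fin => ux xy.
by rewrite -[y](subrK x) -addrA; exact: interior_coneD.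
Qed.

(** From [y], move along an interior direction [k] and stop at the infimum of the levels with a
    point of [A] strictly below. Openness of the interior of [K] gives both halves of [WInfP]
    there. *)
Lemma WInf_above (A : set (\bar Y)) (a0 y : Y) : A a0%:E ->
  (forall a, A a -> ~ ltK K a y%:E) ->
  exists2 y', WInf K A y'%:E & K (y' - y).
Proof.
move=> Aa0 Ay; have [k Kk] := K_int; have Kk' := interior_subset Kk.
have K0 : K 0 by apply: (closed_cone0 K_cone K_closed); exists k.
have KZ t : 0 <= t -> K (t *: k).
  rewrite le_eqVlt => /predU1P[<-|t0]; first by rewrite scale0r.
  exact: K_cone.
pose S := [set t : R | exists2 a, A a & ltK K a (y + t *: k)%:E].
have S_ge0 : lbound S 0.
  move=> t [a Aa ay]; rewrite leNgt; apply/negP => t0; apply: (Ay a Aa).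
  apply: (ltK_leK_trans ay); rewrite opprD addrA subrr add0r -scaleNr.
  by apply: KZ; rewrite oppr_ge0 ltW.
have S_neq0 : S !=set0.
  have [t _ Kt] := interior_cone_absorb K_cone (y - a0) Kk.
  by exists t, a0%:E => //; apply/ltK_fin; rewrite addrAC addrC.
have y'E t s : y + t *: k - (y + s *: k) = (t - s) *: k.
  by rewrite opprD addrACA subrr add0r scalerBl.
exists (y + inf S *: k); last first.
  by rewrite addrC addKr; apply: KZ; exact: lb_le_inf.
apply/WInfP; split=> [[a||] Aa|[w||//]].
- move=> /ltK_fin ay'.
  have /(nbhs_absorb k)[d d0 dK] : nbhs (y + inf S *: k - a) K°.
    by apply: open_nbhs_nbhs; split => //; exact: open_interior.
  have : S (inf S - d / 2).
    exists a%:E => //; apply/ltK_fin.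
    have -> : y + (inf S - d / 2) *: k - a =
        (y + inf S *: k - a) + - (d / 2) *: k.
      by rewrite scalerDl addrA [LHS]addrAC.
    by apply: dK; rewrite normrN gtr0_norm ?divr_gt0//; lra.
  have lbS : has_lbound S by exists 0.
  by move=> /(ge_inf lbS); lra.
- by case.
- by move=> _; apply: (Ay _ Aa).
- move=> /ltK_fin y'w.
  have /(nbhs_absorb k)[d d0 dK] : nbhs (w - (y + inf S *: k)) K°.
    by apply: open_nbhs_nbhs; split => //; exact: open_interior.
  have [|t [a Aa ay] tS] := @inf_lt _ S (inf S + d / 2) S_neq0; first lra.
  exists a => //; apply: (ltK_leK_trans ay).
  have /dK/interior_subset Kd : `|- (d / 2)| < d.
    by rewrite normrN gtr0_norm ?divr_gt0//; lra.
  have -> : w - (y + t *: k) = (w - (y + inf S *: k) + - (d / 2) *: k) +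
      (inf S + d / 2 - t) *: k.
    rewrite -addrA -scalerDl.
    have -> : - (d / 2) + (inf S + d / 2 - t) = inf S - t by lra.
    by rewrite -y'E addrA subrK.
  apply: (convex_coneD K_cvx K_cone Kd); apply: KZ; lra.
- by move=> _; exists a0%:E.
Qed.

Lemma WInf_eq_WMax_value (A M : set (\bar Y)) (a0 : Y) : A a0%:E ->
  (forall m a, M m -> A a -> ~ ltK K a m) ->
  (forall y, WInf K A y%:E -> M y%:E) ->
  WInf K A = WMax_value K M.
Proof.
move=> Aa0 weak attained.
(* For finite [w], if no point of [A] were strictly below [w], [WInf_above] would give a weak
   infimum above [w], hence an element of [M] strictly above [v]. *)
have below v w : (forall m, M m -> ~ ltK K v m) -> ltK K v w ->
    exists2 a, A a & ltK K a w.
  case: w => [w||] vM vw; last 2 first.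
  - by exists a0%:E.
  - by case: v vw {vM} => [?||] [].
  apply: contrapT => Aw.
  have [a Aa aw|y' y'inf wy'] := WInf_above Aa0 (y := w).
    by apply: Aw; exists a.
  by apply: (vM _ (attained _ y'inf)); exact: ltK_leK_trans vw wy'.
apply/seteqP; split=> v.
- move=> /[dup] vinf /WInfP[v1 v2].
  have vM m : M m -> ~ ltK K v m by move=> Mm /v2[a Aa]; exact: weak.
  case: v => [y||] in vinf v1 v2 vM *.
  + left; split; first exact: attained.
    by split=> // w wy; exists y%:E => //; exact: attained.
  + by case: (v1 _ Aa0).
  (* Here [v = -oo]: no element of [M] exceeds it, so [M] is empty, the case of the convention in
     [WMax_value], or consists of [-oo] alone. *)
  + have [->|/set0P[m Mm]] := eqVneq M set0; first by right.
    have mE : m = -oo%E by case: m Mm => [m||] // /vM; case.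
    by left; rewrite mE in Mm *; do 2!split => //; case.
- case=> [[Mv [vM _]]|[M0 ->]]; apply/WInfP; split=> [a Aa|w].
  + exact: weak.
  + exact: below.
  + by case: a Aa => [?||] _ [].
  + by apply: below => m; rewrite M0.
Qed.

End extended_order.

Lemma lin_subspace (R : realType) (V : lmodType R) (A : set V) :
  linear_subspace (lin A).
Proof.
split=> [F [[]//]|a u v uA vA F FA].
by have [[_ Flin] _] := FA; apply: Flin; [exact: uA|exact: vA].
Qed.

(** * Weak duality and dual attainment *)

Section perturbation_duality.
Context {R : realType} {X Y Z : tvsType R}.
Variables (K : set Y) (Phi : X * Z -> \bar Y).
Variable L : {linear X -> Y}.

(** At [(x, 0)] the term in [T] vanishes, so the negated primal values are among the elements whose
    weak supremum is the conjugate. *)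
Lemma weak_duality (T : {linear Z -> Y}) (m : \bar Y) (x : X) :
  (oppe @` conjugate K Phi L T) m ->
  ~ ltK K (Phi (x, 0%R) - (L x)%:E)%E m.
Proof.
move=> [c [cub _] <-]; rewrite -[X in ltK _ X _]oppe_extK ltKN; apply: cub.
exists (x, 0) => //=; rewrite linear0 addr0.
case: (Phi (x, 0)) => [u||] //.
by rewrite /oppe /adde /= opprB.
Qed.

(** The epigraph of [Phi - L] projected along [X]. *)
Definition image_epigraph : set (Z * Y) :=
  [set p | exists x, leK K (Phi (x, p.1) - (L x)%:E)%E p.2%:E].

Hypothesis Phi_Ninfty : forall p, Phi p <> -oo%E.

Lemma image_epigraphP (p : Z * Y) : image_epigraph p <->
  exists x u, Phi (x, p.1) = u%:E /\ K (p.2 - (u - L x)).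
Proof.
split=> [[x]|[x [u [Pu Ku]]]].
  move: (@Phi_Ninfty (x, p.1)).
  case Pu: (Phi (x, p.1)) => [u||] // _.
  by rewrite leK_fin => Ku; exists x, u.
by exists x; rewrite Pu leK_fin.
Qed.

Hypothesis Phi_cvx : K_convex K Phi.

(** It is the image of the convex [K_epigraph] under the linear map sending [(x, z, y)] to
    [(z, y - L x)]. *)
Lemma image_epigraph_convex : convex_set image_epigraph.
Proof.
have epi (p : Z * Y) : image_epigraph p <->
    exists x, K_epigraph K Phi ((x, p.1), p.2 + L x).
  rewrite image_epigraphP; split=> [[x [u [Pu Ku]]]|[x [k Kk /=]]].
    exists x; exists (p.2 - (u - L x)) => //=.
    rewrite Pu /adde /=; congr EFin.
    by rewrite opprB [RHS]addrC -[RHS]addrA subrK.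
  case Pu: (Phi (x, p.1)) => [u||] // [pE].
  exists x, u; split => //.
  by rewrite opprB addrA pE addrC addKr.
move=> p q l /set_mem/epi[x xp] /set_mem/epi[x' xq].
apply/mem_set/epi.
exists (conv l (x : convex_lmodType X) (x' : convex_lmodType X)).
have := set_mem (Phi_cvx l (mem_set xp) (mem_set xq)).
congr (K_epigraph K Phi _); congr pair.
by rewrite /conv /= [X in _ = _ + X]linearD !linearZ_LR !scalerDr addrACA.
Qed.

Hypotheses (K_proper : K <> [set: Y]) (K_closed : closed K).
Hypotheses (K_cvx : convex_set K) (K_cone : cone K) (K_int : K° !=set0).
Variables (yL v : Y) (V : set Z).
Hypothesis V0 : nbhs 0 V.
Hypothesis regular : forall z, (V `&` lin (pi_dom Phi)) z ->
  exists x : X, leK K (Phi (x, z) - (L x)%:E)%E yL%:E.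
Hypothesis v_inf : primal_value K Phi L v%:E.

(** The minorant of [image_epigraph] given by [affine_minorant] is the dual solution; the last
    clause later yields positivity on [S]. *)
Lemma dual_attainment : exists T : {linear Z -> Y},
  [/\ continuous_linear T, conjugate K Phi L T (- v)%:E &
    forall z x, dom Phi (x, 0) ->
      (forall t : R, 0 < t -> leK K (Phi (x, - (t *: z))) (Phi (x, 0))) ->
      K (T z)].
Proof.
have [v_lb v_glb] := (WInfP _ _ _).1 v_inf.
have KD := interior_coneD K_cvx K_cone.
have [p /image_epigraphP[x [u [Pu _]]]|z Vz Fz|y|T [Tcont Tmin Tpos]] :=
  @affine_minorant R Y Z K image_epigraph (lin (pi_dom Phi)) V yL v
    K_proper K_closed K_cvx K_cone K_int image_epigraph_convex
    (@lin_subspace _ _ _) _ V0 _ _.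
- by apply: sub_gen_smallest; exists (x, p.1); rewrite // /dom /= Pu.
- exact: regular.
- move=> /image_epigraphP[x [u [/= Pu Ku]]] Kvy.
  apply: (v_lb (u - L x)%:E); first by exists x; rewrite // Pu.
  apply/ltK_fin; rewrite -[v](subrK y) addrAC -addrA addrC.
  by apply: KD; rewrite // addrC.
have K0 : K 0.
  apply: (closed_cone0 K_cone K_closed); case: K_int => k Kk.
  by exists k; exact: interior_subset.
exists T; split=> //.
- split.
  + move=> _ [[x z] _ <-] /=.
    move: (@Phi_Ninfty (x, z)).
    case Pu: (Phi (x, z)) => [u||] // _; last by case.
    have Exz : image_epigraph (z, u - L x).
      by apply/image_epigraphP; exists x, u; rewrite subrr.
    rewrite /adde /= => /ltK_fin; rewrite opprK => Kv.
    apply: (Tmin _ Exz) => /=; move: Kv.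
    rewrite opprB; congr (K° _).
    by rewrite [LHS]addrC -[RHS]addrA [T z + _]addrCA !addrA.
  (* Points with [z = 0] already suffice to approach [- v], because [v] is a weak infimum of primal
     values. *)
  + move=> w; rewrite -[w]oppe_extK -[(- v)%:E]/(oppe v%:E) ltKN.
    move=> /v_glb[_ [x _ <-] xw].
    exists (oppe (Phi (x, 0%R) - (L x)%:E)%E); last by rewrite ltKN.
    exists (x, 0) => //=; rewrite linear0 addr0.
    case: (Phi (x, 0)) => [u||] //.
    by rewrite /oppe /adde /= opprB.
- move=> z x; rewrite /dom /=.
  move: (@Phi_Ninfty (x, 0)).
  case Pu: (Phi (x, 0)) => [u||] // _ _ Pz.
  (* With [x] fixed, all points over [- (t *: z)] share the height [u - L x]. *)
  apply: (Tpos z (u - L x)) => t t0; apply/image_epigraphP.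
  have := Pz t t0.
  move: (@Phi_Ninfty (x, - (t *: z))).
  case Pu': (Phi (x, - (t *: z))) => [u'||] // _ /leK_fin Ku.
  exists x, u'; split => //=.
  by rewrite opprB addrA subrK.
Qed.

End perturbation_duality.

(** * Stable strong duality for both dual problems *)

Theorem theorem4p3 (R : realType) (X Y Z : tvsType R)
    (hausX : hausdorff_space X) (hausY : hausdorff_space Y)
    (hausZ : hausdorff_space Z)
    (K : set Y) (K_proper : K <> [set: Y]) (K_closed : closed K)
    (K_cvx : convex_set K) (K_cone : cone K) (K_int : K° !=set0)
    (S : set Z) (S_neq0 : S !=set0) (S_cvx : convex_set S) (S_cone : cone S)
    (Phi : X * Z -> \bar Y) (Phi_Ninfty : forall p, Phi p <> -oo%E)
    (Phi_cvx : K_convex K Phi) (dom0 : pi_dom Phi 0)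
    (regularity : forall L : {linear X -> Y}, continuous_linear L ->
       exists (yL : Y) (VL : set Z), nbhs 0 VL /\
         forall z, (VL `&` lin (pi_dom Phi)) z ->
           exists x : X, leK K (Phi (x, z) - (L x)%:E)%E yL%:E) :
  (forall L : {linear X -> Y}, continuous_linear L ->
     primal_value K Phi L = dual_value K Phi L) /\
  ((exists x0 : X, dom Phi (x0, 0) /\
      forall z, (-%R @` S) z -> leK K (Phi (x0, z)) (Phi (x0, 0))) ->
   forall L : {linear X -> Y}, continuous_linear L ->
     primal_value K Phi L = loose_dual_value S K Phi L).
Proof.
have [[x0 z0] dom_x0 /= z00] := dom0; rewrite {}z00 in dom_x0.
have [a0 Pa0] : exists a0, Phi (x0, 0) = a0%:E.
  move: (Phi_Ninfty (x0, 0)) dom_x0; rewrite /dom /=.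
  by case: (Phi (x0, 0)) => [a||] // _ _; exists a.
(* Both duals are treated at once; they differ only in the set [D] of admissible operators. *)
have duality (L : {linear X -> Y}) (D : set {linear Z -> Y}) :
    (forall y, primal_value K Phi L y%:E ->
      exists2 T, D T & conjugate K Phi L T (- y)%:E) ->
    primal_value K Phi L =
    WMax_value K (\bigcup_(T in D) (oppe @` conjugate K Phi L T)).
  move=> attained.
  apply: (@WInf_eq_WMax_value _ _ _ K_closed K_cvx K_cone K_int _ _ (a0 - L x0)).
  - by exists x0; rewrite // Pa0.
  - by move=> m _ [T DT Tm] [x _ <-]; exact: weak_duality Tm.
  - move=> y /attained[T DT Ty]; exists T => //; exists (- y)%:E => //.
    by rewrite /oppe opprK.
have attained (L : {linear X -> Y}) y : continuous_linear L ->
    primal_value K Phi L y%:E -> exists T, [/\ L_Phi K Phi T,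
      conjugate K Phi L T (- y)%:E & forall z x, dom Phi (x, 0) ->
        (forall t : R, 0 < t -> leK K (Phi (x, - (t *: z))) (Phi (x, 0))) ->
        K (T z)].
  move=> Lcont y_inf; have [yL [V [V0 VL]]] := regularity L Lcont.
  have [T [Tcont Ty Tpos]] := dual_attainment Phi_Ninfty Phi_cvx K_proper
    K_closed K_cvx K_cone K_int V0 VL y_inf.
  (* [L] itself witnesses membership in [L_Phi]: the conjugate contains the finite [- y], so it is
     not reduced to [+oo]. *)
  exists T; split=> //; split=> //; exists L; split=> // conjE.
  by rewrite conjE in Ty.
split=> [L Lcont|[x1 [dom_x1 x1_le]] L Lcont]; apply: duality => y.
- by move=> /(attained _ _ Lcont)[T [TPhi Ty _]]; exists T.
- move=> /(attained _ _ Lcont)[T [TPhi Ty Tpos]]; exists T => //; split=> //.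
  split=> [|_ [s Ss <-]]; first by case: TPhi.
  apply: (Tpos s x1 dom_x1) => t t0; apply: x1_le.
  by exists (t *: s) => //; exact: S_cone.
Qed.
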